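(* Let $r,s$ be positive integers, let $a_1,\dots,a_r,b_1,\dots,b_s,\alpha,\beta,z$ be as in the context, let $\mu$ be an arbitrary order with $\Re(\mu)>0$, and let $\nu$ be a real or complex number. Then, for the right-hand Kober fractional $q$-integral and $q$-derivative acting on functions of $z$, $$K_q^{\nu,\mu}\left[{}_rR_{s,q}\left(a_1,\dots,a_r;b_1,\dots,b_s;\alpha,\beta;\tfrac1z\right)\right]=\frac{\Gamma_q(\nu)}{\Gamma_q(\nu+\mu)}\;{}_{r+1}R_{s+1,q}\left(a_1,\dots,a_r,q^{\nu};b_1,\dots,b_s,q^{\nu+\mu};\alpha,\beta;\tfrac1zq^\mu\right)$$ and $$\mathbb{D}_q^{\nu,\mu}\left[{}_rR_{s,q}\left(a_1,\dots,a_r;b_1,\dots,b_s;\alpha,\beta;\tfrac1z\right)\right]=\frac{\Gamma_q(\nu+\mu)}{\Gamma_q(\nu)}\;{}_{r+1}R_{s+1,q}\left(a_1,\dots,a_r,q^{\nu+\mu};b_1,\dots,b_s,q^{\nu};\alpha,\beta;\tfrac1zq^{-\mu}\right).$$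
   Context: Let $q\in\mathbb{C}$, $0<|q|<1$; complex powers are formed with fixed branches. $(a;q)_0=1$, $(a;q)_n=\prod_{i=0}^{n-1}(1-aq^i)$ for $n\ge1$, $(a;q)_\infty=\prod_{i\ge0}(1-aq^i)$, and $(y)_\lambda=(y;q)_\lambda=\frac{(y;q)_\infty}{(yq^\lambda;q)_\infty}$ for $\lambda\in\mathbb{C}$; $[\lambda]_q=\frac{1-q^\lambda}{1-q}$. $\Gamma_q(x)=\frac{(q;q)_\infty}{(q^x;q)_\infty}(1-q)^{1-x}$, with $1/\Gamma_q(x)$ read as $0$ at its poles. For complex parameters the basic function ${}_rR_{s,q}$ is $${}_rR_{s,q}(a_1,\dots,a_r;b_1,\dots,b_s;\alpha,\beta;z)=\sum_{\ell=0}^\infty\frac{z^\ell(-1)^{(1+s-r)\ell}q^{(1+s-r)\binom{\ell}{2}}}{(q;q)_\ell\,\Gamma_q(\ell\alpha+\beta)}\,\frac{\prod_{i=1}^r(a_i;q)_\ell}{\prod_{j=1}^s(b_j;q)_\ell}.$$ Standing assumption: $a_iq^\ell\ne1$ and $b_jq^\ell\neq1$ for all $i,j$ and all integers $\ell\ge0$. The Jackson integral on $[x,\infty)$ is $\int_x^\infty f(t)\,\mathrm{d}_qt=(1-q)x\sum_{k\ge1}q^{-k}f(xq^{-k})$; the $q$-derivative is $(D_qf)(x)=\frac{f(x)-f(qx)}{(1-q)x}$. The right-hand Kober fractional $q$-integral and $q$-derivative are $$K_q^{\nu,\mu}f(x)=\frac{x^\nu q^{-\nu}}{\Gamma_q(\mu)}\int_x^\infty\left(\tfrac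 xt\right)_{\mu-1}t^{-\nu-1}f(tq^{1-\mu})\,\mathrm{d}_qt\quad(\Re(\mu)>0),$$ $$\mathbb{D}_q^{\nu,\mu}f(x)=\prod_{i=0}^{m-1}\left([\nu+i]_q-xD_q\right)K_q^{\nu+\mu,m-\mu}f(x),\qquad m=[\Re(\mu)]+1,\ m\in\mathbb{N},$$ where $[\Re(\mu)]$ is the integer part.
   Formalization: Each identity is proved whenever its left side is defined (the R-series at the points used and the Jackson integral converge, the kernel has no zero denominator; e.g. divergence can occur for Re ν ≤ 0), with the branch of powers coherent along x q^Z, and for ν, ν+μ where the right-hand R is defined. *)

(* Defs.v *)
From HB Require Import structures.
From mathcomp Require Import all_boot all_order all_algebra complex.
From mathcomp Require Import all_classical all_reals all_analysis.
From mathcomp Require Import ring lra.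

Set Implicit Arguments.
Unset Strict Implicit.
Unset Printing Implicit Defensive.

Import Order.TTheory GRing.Theory Num.Theory.
Import numFieldNormedType.Exports.

Local Open Scope classical_set_scope.
Local Open Scope ring_scope.

(* R[i] has no topology of its own; viewed as an abstract numClosedFieldType it
   gets the topology of its norm, so that limits and series make sense. *)
Definition Cx (R : realType) : numClosedFieldType := R[i].

Definition cexp (R : realType) (z : Cx R) : Cx R :=
  ((expR (complex.Re z) * cos (complex.Im z)) +i*
   (expR (complex.Re z) * sin (complex.Im z)))%C.

(* [lg] is a fixed branch of the logarithm on C \ {0}.  Since |q| <> 1 the
   branch can be chosen coherent along every lattice x q^Z, so that
   (x q^k)^y = x^y (q^y)^k, as the q-calculus requires.  For 0 < q < 1 the
   principal branch qualifies; see [is_qlog_exists] for general q. *)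
Definition is_qlog (R : realType) (q : Cx R) (lg : Cx R -> Cx R) : Prop :=
  (forall x, x != 0 -> cexp (lg x) = x) /\
  (forall x, x != 0 -> lg (x * q) = lg x + lg q).

Section LogExists.
Variable R : realType.

Lemma cexpD (u v : Cx R) : cexp (u + v) = cexp u * cexp v.
Proof.
case: u v => [a b] [c d]; rewrite /cexp /=; apply/eqP.
rewrite expRD cosD sinD eq_complex /=; apply/andP; split; apply/eqP; ring.
Qed.

Lemma cexp0 : cexp (0 : Cx R) = 1.
Proof. by rewrite /cexp /= expR0 cos0 sin0 mulr1 mulr0. Qed.

Lemma cexp_surj (z : Cx R) : z != 0 -> exists w : Cx R, cexp w = z.
Proof.
case: z => x y; rewrite eq_complex /= negb_and => z0.
pose rho := Num.sqrt (x ^+ 2 + y ^+ 2).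
have n0 : 0 < x ^+ 2 + y ^+ 2.
  rewrite lt_neqAle addr_ge0 ?sqr_ge0// andbT eq_sym paddr_eq0 ?sqr_ge0//.
  by rewrite !sqrf_eq0 negb_and.
have rho0 : 0 < rho by rewrite sqrtr_gt0.
have rhoN : rho != 0 by rewrite lt0r_neq0.
have rho2 : rho ^+ 2 = x ^+ 2 + y ^+ 2 by rewrite sqr_sqrtr// ltW.
clearbody rho.
have xr : -1 <= x / rho <= 1.
  rewrite -ler_norml normrM normfV (gtr0_norm rho0) ler_pdivrMr// mul1r.
  rewrite -(@ler_pXn2r _ 2) ?nnegrE// ?(ltW rho0)//.
  by rewrite real_normK ?num_real// rho2 lerDl sqr_ge0.
have sE : Num.sqrt (1 - (x / rho) ^+ 2) = `|y| / rho.
  have -> : 1 - (x / rho) ^+ 2 = (y / rho) ^+ 2.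
    rewrite !exprMn !exprVn; apply/eqP; rewrite subr_eq -mulrDl addrC -rho2.
    by rewrite divff// expf_neq0.
  by rewrite sqrtr_sqr normrM normfV (gtr0_norm rho0).
pose t := if 0 <= y then acos (x / rho) else - acos (x / rho).
exists (ln rho +i* t)%C.
have ct : cos t = x / rho by rewrite /t; case: ifP => _; rewrite ?cosN acosK.
have st : sin t = y / rho.
  rewrite /t; case: ifPn => [y0|]; first by rewrite sin_acos// sE ger0_norm.
  by rewrite -ltNge sinN sin_acos// sE => y0; rewrite ltr0_norm// mulNr opprK.
rewrite /cexp [complex.Re _]/= [complex.Im _]/= lnK// ct st.
by rewrite ![rho * _]mulrC !divfK.
Qed.

Lemma cexp_int (w : Cx R) (n : int) : cexp (n%:~R * w) = cexp w ^ n.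
Proof.
have cexpX (m : nat) : cexp (m%:R * w) = cexp w ^+ m.
  elim: m => [|m IH]; first by rewrite mul0r cexp0.
  by rewrite -natr1 mulrDl mul1r cexpD IH exprSr.
case: n => m; first exact: cexpX.
rewrite NegzE -exprnN -cexpX mulrNz mulNr.
have h : cexp (- (m.+1%:R * w)) * cexp (m.+1%:R * w) = 1.
  by rewrite -cexpD addNr cexp0.
have N0 : cexp (m.+1%:R * w) != 0.
  by apply: contra_eq_neq h => ->; rewrite mulr0 eq_sym oner_eq0.
by apply: (mulIf N0); rewrite h mulVf.
Qed.

Lemma is_qlog_exists (q : Cx R) :
  0 < `|q| -> `|q| < 1 -> exists lg, is_qlog q lg.
Proof.
move=> q0 q1.
have qN : q != 0 by rewrite -normr_gt0.
have [L0 [L0P L01]] : exists L0 : Cx R -> Cx R,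
    (forall x, x != 0 -> cexp (L0 x) = x) /\ L0 1 = 0.
  have /choice[L0 L0P] : forall x : Cx R,
      exists w, (x != 0 -> cexp w = x) /\ (x = 1 -> w = 0).
    move=> x; have [->|x1] := eqVneq x 1; first by exists 0; rewrite cexp0.
    have [->|/cexp_surj[w wP]] := eqVneq x 0.
      by exists 0; split=> // /esym/eqP; rewrite oner_eq0.
    by exists w; split=> // /eqP; rewrite (negbTE x1).
  by exists L0; split=> [x /(proj1 (L0P x))//|]; exact: (proj2 (L0P 1)).
pose nr (x : Cx R) : R := ComplexField.Normc.normc x.
have nrE (x : Cx R) : `|x| = (nr x)%:C%C by [].
have nr0 x : x != 0 -> 0 < nr x.
  by rewrite -normr_gt0 nrE ltcR.
have lnq : ln (nr q) != 0.
  by rewrite lt_eqF// ln_lt0// nr0//=; move: q1; rewrite nrE ltcR.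
pose n (x : Cx R) : int := Num.floor (ln (nr x) / ln (nr q)).
have n1 : n 1 = 0.
  rewrite /n; have -> : nr 1 = 1.
    by apply: complexI; rewrite -nrE normr1.
  by rewrite ln1 mul0r floor0.
have nS x : x != 0 -> n (x * q) = n x + 1.
  move=> x0; rewrite /n; have -> : nr (x * q) = nr x * nr q.
    exact: ComplexField.Normc.normcM.
  rewrite lnM ?posrE ?nr0// mulrDl divff//.
  by rewrite floorDrz ?rpred1// floor1.
pose lg x := L0 (x * q ^ (- n x)) + (n x)%:~R * L0 q.
have lgS x : x != 0 -> lg (x * q) = lg x + L0 q.
  move=> x0; rewrite /lg nS//.
  have -> : x * q * q ^ (- (n x + 1)) = x * q ^ (- n x).
    by rewrite -mulrA -{1}[q]expr1z -expfzDr// opprD addrCA subrr addr0.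
  by rewrite intrD mulrDl mul1r addrA.
have lgq : lg q = L0 q.
  by rewrite -[q in LHS]mul1r lgS ?oner_eq0// /lg n1 oppr0 expr0z mulr1 L01
     mul0r !add0r.
exists lg; split=> [x x0|x x0]; last by rewrite lgS// lgq.
rewrite /lg cexpD cexp_int !L0P ?mulf_neq0 ?expfz_neq0//.
by rewrite -mulrA -expfzDr// addNr expr0z mulr1.
Qed.

End LogExists.

Section QCalculus.
Variables (R : realType) (q : Cx R) (lg : Cx R -> Cx R).
Implicit Types (x y z lam mu nu alpha beta : Cx R) (f : Cx R -> Cx R).

Definition cpow x y : Cx R := cexp (y * lg x).

Definition qpoch x (n : nat) : Cx R := \prod_(i < n) (1 - x * q ^+ i).

Definition qpochoo x : Cx R := limn (qpoch x).

Definition qpochc y lam : Cx R := qpochoo y / qpochoo (y * cpow q lam).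

Definition qnum lam : Cx R := (1 - cpow q lam) / (1 - q).

(* At a pole of Gamma_q the denominator vanishes, so that both qGamma x and
   (qGamma x)^-1 are 0 there, as 1 / Gamma_q should be. *)
Definition qGamma x : Cx R :=
  qpochoo q / qpochoo (cpow q x) * cpow (1 - q) (1 - x).

(* The exponent 1 + s - r may be negative, hence integer powers. *)
Definition qR_term (r s : nat) (a : r.-tuple (Cx R)) (b : s.-tuple (Cx R))
    alpha beta z (l : nat) : Cx R :=
  let e : int := 1 + s%:Z - r%:Z in
  (z ^+ l * (-1) ^ (e * l%:Z) * q ^ (e * ('C(l, 2))%:Z)) /
    (qpoch q l * qGamma (l%:R * alpha + beta)) *
  ((\prod_(c <- a) qpoch c l) / (\prod_(c <- b) qpoch c l)).

Definition qR (r s : nat) (a : r.-tuple (Cx R)) (b : s.-tuple (Cx R))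
    alpha beta z : Cx R :=
  limn (series (qR_term a b alpha beta z)).

Definition qR_cvg (r s : nat) (a : r.-tuple (Cx R)) (b : s.-tuple (Cx R))
    alpha beta z : Prop :=
  cvgn (series (qR_term a b alpha beta z)).

Definition qR_params (r s : nat) (a : r.-tuple (Cx R)) (b : s.-tuple (Cx R)) :
    Prop :=
  (forall i (l : nat), tnth a i * q ^+ l != 1) /\
  (forall j (l : nat), tnth b j * q ^+ l != 1).

(* The sum over k >= 1 is indexed from 0. *)
Definition jackson_term f x (k : nat) : Cx R :=
  q ^- k.+1 * f (x * q ^- k.+1).

Definition jackson f x : Cx R :=
  (1 - q) * x * limn (series (jackson_term f x)).

Definition jackson_cvg f x : Prop := cvgn (series (jackson_term f x)).

Definition qderiv f x : Cx R := (f x - f (q * x)) / ((1 - q) * x).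

Definition kober_integrand nu mu f x : Cx R -> Cx R := fun t =>
  qpochc (x / t) (mu - 1) * cpow t (- nu - 1) * f (t * cpow q (1 - mu)).

Definition koberK nu mu f x : Cx R :=
  cpow x nu * cpow q (- nu) / qGamma mu *
  jackson (kober_integrand nu mu f x) x.

(* koberK nu mu f x is meaningful for a function f defined on D: f is evaluated
   inside D, the kernel (x/t)_{mu-1} has no zero denominator (automatic when
   0 < q < 1 and Re mu > 0), and the Jackson integral converges. *)
Definition koberK_defined nu mu (D : set (Cx R)) f x : Prop :=
  [/\ forall k : nat, D (x * q ^- k.+1 * cpow q (1 - mu)),
      forall k : nat,
        qpochoo (x / (x * q ^- k.+1) * cpow q (mu - 1)) != 0 &
      jackson_cvg (kober_integrand nu mu f x) x].

Definition kober_order mu : nat := (Num.truncn (complex.Re mu)).+1.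

Definition kober_factor lam f : Cx R -> Cx R := fun x =>
  qnum lam * f x - x * qderiv f x.

Definition koberD nu mu f : Cx R -> Cx R :=
  let m := kober_order mu in
  (\big[comp/id]_(i < m) kober_factor (nu + i%:R))
    (koberK (nu + mu) (m%:R - mu) f).

(* The m factors [nu + i]_q - x D_q evaluate the fractional integral at
   x, x q, ..., x q^m. *)
Definition koberD_defined nu mu (D : set (Cx R)) f x : Prop :=
  let m := kober_order mu in
  forall j : nat, (j <= m)%N ->
    koberK_defined (nu + mu) (m%:R - mu) D f (x * q ^+ j).

End QCalculus.

(* Main.v *)
Require Import Defs.
From HB Require Import structures.
From mathcomp Require Import all_boot all_order all_algebra complex.
From mathcomp Require Import all_classical all_reals all_analysis.
From mathcomp Require Import ring lra.

(** Write p = q^nu, a = q^mu, w = q^mu / x, and let f(x) = sum_l c_l x^(- l).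
    In the Jackson sum of the Kober integrand at the point x q^(- k - 1) the
    kernel (q^(k+1))_(mu - 1) is, up to a constant, the q-binomial coefficient
    A_k = (a;q)_k / (q;q)_k, the powers of t contribute p^k, and f is evaluated
    where 1/t becomes w q^k.  Hence, up to constants,

      K f (x) = sum_k A_k p^k (sum_l c_l w^l q^(k l))
              = sum_l c_l w^l (sum_k A_k (p q^l)^k),

    and the q-binomial theorem [qbinomial] sums the inner series to
    (a p q^l)_oo / (p q^l)_oo, which is the constant (a p)_oo / (p)_oo times
    (p;q)_l / (a p;q)_l.  The latter are the two new parameters of the series
    on the right-hand side, and the constants collect into
    Gamma_q(nu) / Gamma_q(nu + mu) [koberK_series].

    The delicate point is the exchange of the sums.  The term k = 0 is the
    series of f at w, possibly on the boundary of its disk of convergence,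
    where it need not converge absolutely; and |p| >= 1 is possible if c_0 = 0.
    [exchange_sums] deals with both: convergence of the outer sum alone forces
    |p q^m| < 1, where c_m is the first nonzero coefficient, and for the terms
    k >= 1 the factor q^(k l) gives geometric bounds.  The same lemma yields
    the convergence of the series on the right-hand side.

    For the q-derivative, each factor [nu + i]_q - x D_q multiplies x^(- l) by
    (q^(- l) - q^(nu + i)) / (1 - q) [kober_factors_series].  Applied to the
    series for K^(nu + mu, m - mu) f at the points x q^j, j <= m, the m factors
    turn (q^(nu + m);q)_l into (q^nu;q)_l and q^(m - mu) into q^(- mu)
    [koberD_series]. *)

Set Implicit Arguments.
Unset Strict Implicit.
Unset Printing Implicit Defensive.

Import Order.TTheory GRing.Theory Num.Theory.
Import numFieldNormedType.Exports.

Local Open Scope classical_set_scope.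
Local Open Scope ring_scope.

(** * Limits and series of complex numbers *)

(** The norm of [Cx R] takes complex values; its real part is what can be
   compared with real sequences. *)
Definition modulus (R : realType) (x : Cx R) : R := ComplexField.Normc.normc x.

(** Limits over an arbitrary [numFieldType]: unification at this generality
   keeps [Cx R] folded, whereas on [R[i]] itself no topology is declared. *)
Lemma cvgB_num (K : numFieldType) (u v : nat -> K) (a b : K) :
  u @ \oo --> a -> v @ \oo --> b -> (fun n => u n - v n) @ \oo --> a - b.
Proof. exact: cvgB. Qed.

Lemma cvgD_num (K : numFieldType) (u v : nat -> K) (a b : K) :
  u @ \oo --> a -> v @ \oo --> b -> (fun n => u n + v n) @ \oo --> a + b.
Proof. exact: cvgD. Qed.

Lemma cvgM_num (K : numFieldType) (u v : nat -> K) (a b : K) :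
  u @ \oo --> a -> v @ \oo --> b -> (fun n => u n * v n) @ \oo --> a * b.
Proof. exact: cvgM. Qed.

Lemma cvgMl_num (K : numFieldType) (c : K) (u : nat -> K) (a : K) :
  u @ \oo --> a -> (fun n => c * u n) @ \oo --> c * a.
Proof. by move=> h; apply: cvgM_num => //; exact: cvg_cst. Qed.

Lemma cvgV_num (K : numFieldType) (u : nat -> K) (a : K) :
  a != 0 -> u @ \oo --> a -> (fun n => (u n)^-1) @ \oo --> a^-1.
Proof. exact: cvgV. Qed.

Lemma cvgS_num (K : numFieldType) (u : nat -> K) (a : K) :
  u @ \oo --> a -> (fun n => u n.+1) @ \oo --> a.
Proof. by have -> := cvg_shiftS u (nbhs a). Qed.

Lemma cvg_addnE (K : numFieldType) (u : nat -> K) (m : nat) (a : K) :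
  ((fun n => u (m + n)%N) @ \oo --> a) = (u @ \oo --> a).
Proof.
under eq_fun do rewrite addnC.
exact: (@cvg_shiftn m _ u (nbhs a)).
Qed.

Lemma cvg_addn (K : numFieldType) (m : nat) (u : nat -> K) (a : K) :
  u @ \oo --> a -> (fun n => u (m + n)%N) @ \oo --> a.
Proof. by rewrite cvg_addnE. Qed.

Lemma cvg_addn_inv (K : numFieldType) (m : nat) (u : nat -> K) (a : K) :
  (fun n => u (m + n)%N) @ \oo --> a -> u @ \oo --> a.
Proof. by rewrite cvg_addnE. Qed.

Lemma cvg_series_scale (K : numFieldType) (c : K) (u : nat -> K) (a : K) :
  series u @ \oo --> a -> series (fun n => c * u n) @ \oo --> c * a.
Proof.
move=> h; have := cvgMl_num (c := c) h; rewrite /series /=.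
by under eq_fun do rewrite mulr_sumr.
Qed.

Lemma cvg_series_eq (K : numFieldType) (u v : nat -> K) (a : K) :
  u =1 v -> series u @ \oo --> a -> series v @ \oo --> a.
Proof. by move=> /funext ->. Qed.

Lemma cvg_seriesB (K : numFieldType) (u v : nat -> K) (a b : K) :
  series u @ \oo --> a -> series v @ \oo --> b ->
  series (fun n => u n - v n) @ \oo --> a - b.
Proof.
move=> hu hv; have := cvgB_num hu hv; rewrite /series /=.
by under eq_fun do rewrite -sumrB.
Qed.

Lemma cvg_series_to0 (K : numFieldType) (u : nat -> K) (a : K) :
  series u @ \oo --> a -> u @ \oo --> (0 : K).
Proof. by move=> h; apply: cvg_series_cvg_0; apply/cvg_ex; exists a. Qed.

Lemma series_skip (K : numFieldType) (u : nat -> K) (m n : nat) :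
  (forall l, (l < m)%N -> u l = 0) ->
  series u (m + n) = series (fun l => u (m + l)%N) n.
Proof.
move=> u0; rewrite /series /= (big_cat_nat (n := m)) ?leq_addr//=.
rewrite [X in X + _]big_nat_cond [X in X + _]big1 ?add0r; last first.
  by move=> i /andP[/andP[_ im] _]; exact: u0.
by rewrite -{1}(add0n m) big_addn addKn; apply: eq_bigr => i _; rewrite addnC.
Qed.

Lemma cvg_sum_num (K : numFieldType) (c a : nat -> K) (u : nat -> nat -> K)
    (n : nat) :
  (forall j, u j @ \oo --> a j) ->
  (fun L => \sum_(0 <= j < n) c j * u j L) @ \oo -->
  \sum_(0 <= j < n) c j * a j.
Proof.
move=> h; elim: n => [|n IH].
  by under eq_fun do rewrite big_geq//; rewrite big_geq//; exact: cvg_cst.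
rewrite big_nat_recr//=; under eq_fun do rewrite big_nat_recr//=.
by apply: cvgD_num => //; exact: cvgMl_num.
Qed.

Lemma cvg_series0 (K : numFieldType) (u : nat -> K) :
  (forall n, u n = 0) -> series u @ \oo --> (0 : K).
Proof.
move=> u0; rewrite (_ : series u = fun=> 0); first exact: cvg_cst.
by apply/funext => n; rewrite /series /= big1.
Qed.

Lemma geometric_sum_le (K : realFieldType) (rho : K) (n : nat) :
  0 <= rho -> rho < 1 -> \sum_(i < n) rho ^+ i <= (1 - rho)^-1.
Proof.
move=> r0 r1; have d0 : 0 < 1 - rho by rewrite subr_gt0.
rewrite -[leRHS]mul1r ler_pdivlMr//.
have -> : (\sum_(i < n) rho ^+ i) * (1 - rho) = 1 - rho ^+ n.
  elim: n => [|k IHk]; first by rewrite big_ord0 mul0r expr0 subrr.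
  by rewrite big_ord_recr /= mulrDl IHk exprSr; ring.
by rewrite gerBl exprn_ge0.
Qed.

Section Modulus.
Variable R : realType.
Implicit Types x y : Cx R.

Lemma normE x : `|x| = ((modulus x)%:C)%C :> Cx R. Proof. by []. Qed.

Lemma modulus_ge0 x : 0 <= modulus x.
Proof. by have := normr_ge0 x; rewrite normE lecR. Qed.

Lemma modulusM x y : modulus (x * y) = modulus x * modulus y.
Proof. exact: ComplexField.Normc.normcM. Qed.

Lemma modulus0 : modulus (0 : Cx R) = 0.
Proof. exact: ComplexField.Normc.normc0. Qed.

Lemma modulus1 : modulus (1 : Cx R) = 1.
Proof. exact: ComplexField.Normc.normc1. Qed.

Lemma modulusX x n : modulus (x ^+ n) = modulus x ^+ n.
Proof.
by elim: n => [|n IH]; rewrite ?expr0 ?modulus1// !exprS modulusM IH.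
Qed.

Lemma modulusN x : modulus (- x) = modulus x.
Proof. by apply: complexI; rewrite -!normE normrN. Qed.

Lemma modulus_distC x y : modulus (x - y) = modulus (y - x).
Proof. by rewrite -modulusN opprB. Qed.

Lemma ler_modulusD x y : modulus (x + y) <= modulus x + modulus y.
Proof. by rewrite -lecR rmorphD/= -!normE ler_normD. Qed.

Lemma ler_modulusB x y : modulus x - modulus y <= modulus (x - y).
Proof. by rewrite lerBlDr; rewrite -{1}(subrK y x) ler_modulusD. Qed.

Lemma modulus_eq0 x : (modulus x == 0) = (x == 0).
Proof.
apply/eqP/eqP => [|->]; last exact: modulus0.
exact: ComplexField.Normc.eq0_normc.
Qed.

Lemma modulus_gt0 x : (0 < modulus x) = (x != 0).
Proof. by rewrite lt_def modulus_ge0 andbT modulus_eq0. Qed.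

Lemma modulus_sum (I : Type) (s : seq I) (P : pred I) (F : I -> Cx R) :
  modulus (\sum_(i <- s | P i) F i) <= \sum_(i <- s | P i) modulus (F i).
Proof.
elim/big_rec2 : _ => [|i y x _ h]; first by rewrite modulus0.
by rewrite (le_trans (ler_modulusD _ _))// lerD2l.
Qed.

Lemma ler_Re_modulus x : `|complex.Re x| <= modulus x.
Proof. by rewrite -lecR -normE normc_ge_Re. Qed.

Lemma ler_Im_modulus x : `|complex.Im x| <= modulus x.
Proof.
case: x => a b; rewrite /modulus /= -(sqrtr_sqr b).
by apply: ler_wsqrtr; rewrite lerDr sqr_ge0.
Qed.

Lemma ler_modulus_ReIm x :
  modulus x <= `|complex.Re x| + `|complex.Im x|.
Proof.
case: x => a b; rewrite [X in modulus X]
  (_ : (a +i* b)%C = (a%:C)%C + (0 +i* b)%C); last first.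
  by apply/eqP; rewrite eq_complex /= addr0 add0r !eqxx.
rewrite (le_trans (ler_modulusD _ _))//= /modulus /=.
by rewrite !expr0n /= addr0 add0r !sqrtr_sqr.
Qed.

(** The real-valued modulus transports the squeeze and comparison theorems,
   stated for real sequences, to complex ones. *)
Lemma cvg_modulusP (u : nat -> Cx R) (l : Cx R) :
  u @ \oo --> l <-> (fun n => modulus (l - u n)) @ \oo --> (0 : R).
Proof.
split.
  move=> /cvgrPdist_lt h; apply/cvgrPdist_lt => e e0.
  have /h : 0 < (e%:C)%C :> Cx R by rewrite ltcR.
  apply: filterS => n; rewrite normE ltcR => hn.
  by rewrite sub0r normrN ger0_norm ?modulus_ge0.
move=> /cvgrPdist_lt h; apply/cvgrPdist_lt => e.
case: e => a b; rewrite ltcE /= => /andP[/eqP -> a0].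
have := h _ a0; apply: filterS => n.
by rewrite sub0r normrN ger0_norm ?modulus_ge0// normE ltcR.
Qed.

Lemma cvg_modulus (u : nat -> Cx R) (l : Cx R) :
  u @ \oo --> l -> (fun n => modulus (u n)) @ \oo --> modulus l.
Proof.
move=> /cvg_modulusP h; apply/cvgrPdist_lt => e e0.
move/cvgrPdist_lt : h => /(_ _ e0); apply: filterS => n.
rewrite sub0r normrN (ger0_norm (modulus_ge0 _)); apply: le_lt_trans.
rewrite ler_norml lerNl opprB {1}modulus_distC.
by rewrite !ler_modulusB.
Qed.

Lemma modulus_lim_le (u : nat -> Cx R) (l : Cx R) (b : R) :
  u @ \oo --> l -> (\forall n \near \oo, modulus (u n) <= b) ->
  modulus l <= b.
Proof.
move=> /cvg_modulus h hb.
rewrite -(cvg_lim (@Rhausdorff R) h); apply: limr_le => //.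
by apply/cvg_ex; exists (modulus l).
Qed.

Lemma modulus_lim_ge (u : nat -> Cx R) (l : Cx R) (b : R) :
  u @ \oo --> l -> (\forall n \near \oo, b <= modulus (u n)) ->
  b <= modulus l.
Proof.
move=> /cvg_modulus h hb.
rewrite -(cvg_lim (@Rhausdorff R) h); apply: limr_ge => //.
by apply/cvg_ex; exists (modulus l).
Qed.

Lemma cvg_modulus_bounded (u : nat -> Cx R) (l : Cx R) :
  u @ \oo --> l -> exists2 M : R, 0 <= M & forall n, modulus (u n) <= M.
Proof.
move=> /cvg_modulus h.
have /cvg_seq_bounded [M [_ hM]] : cvgn (fun n => modulus (u n)).
  by apply/cvg_ex; exists (modulus l).
exists (`|M| + 1) => [|n]; first by rewrite addr_ge0.
have M1 : M < `|M| + 1 by rewrite (le_lt_trans (ler_norm M))// ltrDl.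
by have /= := hM _ M1 n I; rewrite ger0_norm ?modulus_ge0.
Qed.

Lemma Cx_hausdorff : hausdorff_space (Cx R).
Proof. exact: norm_hausdorff. Qed.

Lemma cvg_Cx_unique (u : nat -> Cx R) (l l' : Cx R) :
  u @ \oo --> l -> u @ \oo --> l' -> l = l'.
Proof. by move=> h h'; apply: (cvg_unique _ h h'); exact: Cx_hausdorff. Qed.

Lemma cvg_expr_small (x : Cx R) :
  modulus x < 1 -> (fun n => x ^+ n) @ \oo --> (0 : Cx R).
Proof.
move=> x1; apply/cvg_modulusP.
under eq_fun do rewrite sub0r modulusN modulusX.
by apply: cvg_expr; rewrite ger0_norm ?modulus_ge0.
Qed.

(** Completeness of the complex plane, in the form of the comparison with a
   geometric series: the real and the imaginary parts converge absolutely. *)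
Lemma cvg_series_geometric (u : nat -> Cx R) (B rho : R) :
  0 <= rho -> rho < 1 -> (forall n, modulus (u n) <= B * rho ^+ n) ->
  cvgn (series u).
Proof.
move=> r0 r1 hu.
have real_cvg (g : Cx R -> R) : (forall x, `|g x| <= modulus x) ->
    cvgn (series (g \o u)).
  move=> hg; apply: normed_cvg.
  apply: (@series_le_cvg _ _ (geometric B rho)) => [n|n|n|] //=.
  - by rewrite (le_trans (modulus_ge0 (u n))).
  - exact: le_trans (hg _) (hu _).
  - by apply: is_cvg_geometric_series; rewrite ger0_norm.
have /cvg_ex [a ha] := real_cvg _ ler_Re_modulus.
have /cvg_ex [b hb] := real_cvg _ ler_Im_modulus.
apply/cvg_ex; exists (a +i* b)%C; apply/cvg_modulusP.
have h0 : (fun n => `|a - series (@complex.Re R \o u) n| +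
             `|b - series (@complex.Im R \o u) n|) @ \oo --> (0 : R).
  rewrite -[X in _ --> X]addr0.
  by apply: cvgD;
    [rewrite -(normr0 R) -(subrr a)|rewrite -(normr0 R) -(subrr b)];
    apply: cvg_norm; apply: cvgB => //; exact: cvg_cst.
apply: (squeeze_cvgr _ (cvg_cst 0) h0).
apply: nearW => n; rewrite modulus_ge0/=.
apply: le_trans (ler_modulus_ReIm _) _.
rewrite !raddfB /= /series /=.
by rewrite (raddf_sum (@complex.Re R)) (raddf_sum (@complex.Im R)).
Qed.

(** The bound holds for every block of terms n <= k < N, hence in the limit. *)
Lemma series_tail_geometric (u : nat -> Cx R) (l : Cx R) (B rho : R) n :
  0 <= rho -> rho < 1 -> (forall k, modulus (u k) <= B * rho ^+ k) ->
  series u @ \oo --> l ->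
  modulus (l - series u n) <= B * rho ^+ n / (1 - rho).
Proof.
move=> r0 r1 hu hl.
have B0 : 0 <= B by have := le_trans (modulus_ge0 _) (hu 0%N); rewrite mulr1.
have d0 : 0 < 1 - rho by rewrite subr_gt0.
apply: (@modulus_lim_le (fun N => series u N - series u n)).
  by apply: cvgB_num; [exact: hl|exact: cvg_cst].
exists n => // N /= nN.
rewrite sub_series_geq//.
apply: le_trans (modulus_sum _ _ _) _.
apply: (@le_trans _ _ (\sum_(n <= k < N) B * rho ^+ k)).
  by apply: ler_sum => k _; exact: hu.
rewrite -mulr_sumr -mulrA ler_wpM2l// ler_pdivlMr//.
have -> : (\sum_(n <= k < N) rho ^+ k) * (1 - rho) = rho ^+ n - rho ^+ N.
  rewrite mulr_suml (telescope_sumr_eq (fun k => - rho ^+ k))//.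
    by rewrite opprK addrC.
  by move=> k _; rewrite exprSr; ring.
by rewrite gerBl exprn_ge0.
Qed.

End Modulus.

(** * Infinite q-shifted factorials and the q-binomial theorem *)

Section QPochhammer.
Variables (R : realType) (q : Cx R).
Hypothesis q_lt1 : modulus q < 1.
Implicit Types x y a : Cx R.

Let q_ge0 : 0 <= modulus q. Proof. exact: modulus_ge0. Qed.
Let q_gap : 0 < 1 - modulus q. Proof. by rewrite subr_gt0. Qed.

Lemma qpoch0 x : qpoch q x 0 = 1. Proof. by rewrite /qpoch big_ord0. Qed.

Lemma qpochS x n : qpoch q x n.+1 = qpoch q x n * (1 - x * q ^+ n).
Proof. by rewrite /qpoch big_ord_recr. Qed.

Lemma qpochD x m n :
  qpoch q x (m + n) = qpoch q x m * qpoch q (x * q ^+ m) n.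
Proof.
elim: n => [|n IH]; first by rewrite addn0 qpoch0 mulr1.
by rewrite addnS !qpochS IH -!mulrA -exprD.
Qed.

Lemma qpoch_neq0 x n : (forall l, x * q ^+ l != 1) -> qpoch q x n != 0.
Proof.
move=> hx; elim: n => [|n IH]; first by rewrite qpoch0 oner_neq0.
by rewrite qpochS mulf_neq0// subr_eq0 eq_sym.
Qed.

Lemma sum_modulus_le x n :
  \sum_(i < n) modulus (x * q ^+ i) <= modulus x / (1 - modulus q).
Proof.
under eq_bigr do rewrite modulusM modulusX.
by rewrite -mulr_sumr ler_wpM2l ?modulus_ge0// geometric_sum_le.
Qed.

(** From |1 - t| <= exp |t| and the geometric series. *)
Lemma qpoch_bounded x n :
  modulus (qpoch q x n) <= expR (modulus x / (1 - modulus q)).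
Proof.
apply: (@le_trans _ _ (expR (\sum_(i < n) modulus (x * q ^+ i)))); last first.
  by rewrite ler_expR sum_modulus_le.
elim: n => [|n IH]; first by rewrite qpoch0 modulus1 big_ord0 expR0.
rewrite qpochS modulusM big_ord_recr /= expRD.
apply: ler_pM; rewrite ?modulus_ge0//.
apply: le_trans (ler_modulusD _ _) _.
by rewrite modulus1 modulusN expR_ge1Dx.
Qed.

(** Consecutive partial products differ by at most a constant times
   |q| ^ n. *)
Lemma cvg_qpoch x : qpoch q x @ \oo --> qpochoo q x.
Proof.
rewrite /qpochoo.
suff h : cvgn (qpoch q x) by exact: h.
pose u n := - (x * q ^+ n) * qpoch q x n.
have /cvg_ex [l hl] : cvgn (series u).
  apply: (@cvg_series_geometric _ _
    (modulus x * expR (modulus x / (1 - modulus q))) (modulus q)) => // n.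
  rewrite /u modulusM modulusN modulusM modulusX mulrAC.
  by rewrite ler_wpM2r ?exprn_ge0// ler_wpM2l ?modulus_ge0// qpoch_bounded.
apply/cvg_ex; exists (l + 1).
have -> : qpoch q x = (fun n => series u n + 1).
  apply/funext; elim=> [|n IH].
    by rewrite qpoch0 /series /= big_geq// add0r.
  have -> : series u n.+1 = series u n + u n by rewrite /series /= big_nat_recr.
  by rewrite [u n]/u qpochS IH; ring.
by apply: cvgD_num; [exact: hl|exact: cvg_cst].
Qed.

Lemma qpochoo_split x n : qpochoo q x = qpoch q x n * qpochoo q (x * q ^+ n).
Proof.
apply: (cvg_Cx_unique (u := fun k => qpoch q x (n + k))).
  by apply: cvg_addn; exact: cvg_qpoch.
under eq_fun do rewrite qpochD.
by apply: cvgMl_num; exact: cvg_qpoch.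
Qed.

(** A convergent infinite product vanishes only through one of its factors:
   by the Weierstrass inequality prod (1 - t_i) >= 1 - sum t_i the product of
   a remote enough tail stays away from 0. *)
Lemma qpochoo_neq0P x : qpochoo q x != 0 <-> forall l, x * q ^+ l != 1.
Proof.
split=> [h l|h].
  apply: contra_neq h => xl; rewrite (qpochoo_split x l.+1) qpochS xl subrr.
  by rewrite mulr0 mul0r.
(* Past a rank n the factors are so close to 1 that their product is at least
   1/2 in modulus. *)
have [n hn] : exists n, modulus (x * q ^+ n) / (1 - modulus q) <= 1 / 2.
  have /cvg_modulusP/cvgrPdist_lt := cvg_expr_small q_lt1.
  have e0 : 0 < (1 - modulus q) / (2 * (1 + modulus x)).
    by rewrite divr_gt0// mulr_gt0// ltr_wpDr ?modulus_ge0.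
  move=> /(_ _ e0) [n _ /(_ n (leqnn n))] /=.
  rewrite !sub0r normrN modulusN ger0_norm ?modulus_ge0// => hn.
  exists n; rewrite modulusM ler_pdivrMr//.
  have x1 : 0 < 1 + modulus x by rewrite ltr_wpDr ?modulus_ge0.
  apply: (@le_trans _ _ ((1 + modulus x) * modulus (q ^+ n))).
    by rewrite ler_wpM2r ?modulus_ge0// lerDr.
  apply: (@le_trans _ _ ((1 + modulus x) *
                         ((1 - modulus q) / (2 * (1 + modulus x))))).
    by rewrite ler_wpM2l// ltW.
  by rewrite le_eqVlt; apply/orP; left; apply/eqP; field; rewrite gt_eqF.
rewrite (qpochoo_split x n) mulf_neq0 ?qpoch_neq0//.
set y := x * q ^+ n in hn *.
have hy k : 1 - \sum_(i < k) modulus (y * q ^+ i) <= modulus (qpoch q y k).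
  elim: k => [|k IH]; first by rewrite big_ord0 qpoch0 modulus1 subr0.
  have hs m : \sum_(i < m) modulus (y * q ^+ i) <= 1 / 2.
    exact: le_trans (sum_modulus_le _ _) hn.
  have s0 m : 0 <= \sum_(i < m) modulus (y * q ^+ i).
    by apply: sumr_ge0 => i _; exact: modulus_ge0.
  have t1 : modulus (y * q ^+ k) <= 1 / 2.
    by have := hs k.+1; rewrite big_ord_recr /=; have := s0 k; lra.
  rewrite qpochS modulusM big_ord_recr /=.
  have h1 : 1 - modulus (y * q ^+ k) <= modulus (1 - y * q ^+ k).
    by rewrite -[X in X - _](modulus1 R) ler_modulusB.
  apply: le_trans (ler_pM _ _ IH h1).
  - have := s0 k; have := modulus_ge0 (y * q ^+ k); nra.
  - by have := hs k; lra.
  - by lra.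
rewrite -modulus_gt0; apply: (@lt_le_trans _ _ (1 / 2)); first by lra.
apply: modulus_lim_ge; [exact: cvg_qpoch|apply: nearW => k].
apply: le_trans (hy k); have := sum_modulus_le y k.
by lra.
Qed.

Lemma qpochoo_small_neq0 x : modulus x < 1 -> qpochoo q x != 0.
Proof.
move=> x1; apply/qpochoo_neq0P => l; apply: contraTneq x1 => xl.
rewrite -leNgt -[leLHS](modulus1 R) -xl modulusM modulusX.
by rewrite ler_piMr ?modulus_ge0// exprn_ile1// ltW.
Qed.

Definition qbin_coef a j := qpoch q a j / qpoch q q j.

Lemma cvg_qbin_coef a : qbin_coef a @ \oo --> qpochoo q a / qpochoo q q.
Proof.
apply: cvgM_num; first exact: cvg_qpoch.
by apply: cvgV_num; [exact: qpochoo_small_neq0|exact: cvg_qpoch].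
Qed.

(** This recursion becomes the functional equation in the q-binomial
   theorem. *)
Lemma qbin_coefS a j :
  qbin_coef a j.+1 * (1 - q ^+ j.+1) = qbin_coef a j * (1 - a * q ^+ j).
Proof.
have q1 l : q * q ^+ l != 1.
  by move: l; apply/qpochoo_neq0P; exact: qpochoo_small_neq0.
have h0 : 1 - q * q ^+ j != 0 by rewrite subr_eq0 eq_sym.
have hj : qpoch q q j != 0 by exact: qpoch_neq0.
by rewrite /qbin_coef !qpochS exprS; field; apply/andP.
Qed.

(** The q-binomial theorem.  The sum F satisfies
   (1 - y) F(y) = (1 - a y) F(q y), by the recursion on the coefficients;
   iterating this down to F(0) = 1 gives the infinite products. *)
Lemma qbinomial a y : modulus y < 1 ->
  series (fun j => qbin_coef a j * y ^+ j) @ \oo -->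
    qpochoo q (a * y) / qpochoo q y.
Proof.
move=> y1; pose S z := series (fun j => qbin_coef a j * z ^+ j).
have [M M0 hM] := cvg_modulus_bounded (cvg_qbin_coef (a := a)).
pose F z := limn (S z).
have term_le z n : modulus (qbin_coef a n * z ^+ n) <= M * modulus z ^+ n.
  by rewrite modulusM modulusX ler_wpM2r ?exprn_ge0 ?modulus_ge0.
have SF z : modulus z < 1 -> S z @ \oo --> F z.
  move=> z1; suff h : cvgn (S z) by exact: h.
  by apply: (cvg_series_geometric (modulus_ge0 z) z1 (term_le z)).
have qz1 z : modulus z < 1 -> modulus (z * q) < 1.
  move=> z1; rewrite modulusM (le_lt_trans _ z1)//.
  by rewrite ler_piMr ?modulus_ge0// ltW.
have Frec z : modulus z < 1 -> (1 - z) * F z = (1 - a * z) * F (z * q).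
  move=> z1; apply/eqP; rewrite -subr_eq0.
  have -> : (1 - z) * F z - (1 - a * z) * F (z * q) =
      (F z - F (z * q)) - (z * F z - a * z * F (z * q)) by ring.
  rewrite subr_eq0; apply/eqP.
  apply: (cvg_Cx_unique (u := fun n => S z n.+1 - S (z * q) n.+1)).
    by apply: cvgB_num; apply: cvgS_num; apply: SF => //; exact: qz1.
  have -> : (fun n => S z n.+1 - S (z * q) n.+1) =
            (fun n => z * S z n - a * z * S (z * q) n).
    apply/funext => n; rewrite /S /series /= !mulr_sumr -!sumrB.
    rewrite big_nat_recl// !expr0 subrr add0r; apply: eq_bigr => j _.
    rewrite -mulrBr exprMn -[X in X - _]mulr1 -mulrBr mulrCA.
    by rewrite [_ * (1 - _)]qbin_coefS exprMn exprS; ring.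
  by apply: cvgB_num; apply: cvgMl_num; apply: SF => //; exact: qz1.
have yq n : modulus (y * q ^+ n) < 1.
  elim: n => [|n IH]; first by rewrite mulr1.
  by rewrite exprSr mulrA qz1.
have Fiter n : qpoch q y n * F y = qpoch q (a * y) n * F (y * q ^+ n).
  elim: n => [|n IH]; first by rewrite !qpoch0 mulr1.
  rewrite !qpochS mulrAC IH mulrAC -mulrA mulrAC -mulrA.
  by rewrite Frec// exprSr !mulrA mulrAC.
have F1 : (fun n => F (y * q ^+ n)) @ \oo --> (1 : Cx R).
  apply/cvg_modulusP.
  have h0 : (fun n => M / (1 - modulus y) * modulus (0 - q ^+ n)) @ \oo
      --> (0 : R).
    rewrite -[X in _ --> X](mulr0 (M / (1 - modulus y))).
    by apply: cvgMl_num; apply/cvg_modulusP; exact: cvg_expr_small.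
  apply: (squeeze_cvgr _ (cvg_cst 0) h0); apply: nearW => n.
  rewrite modulus_ge0 /= sub0r modulusN modulus_distC.
  have := series_tail_geometric 1 (modulus_ge0 _) (yq n) (term_le _)
    (SF _ (yq n)).
  rewrite /series /= big_nat1 /qbin_coef !qpoch0 expr0 divr1 mulr1 expr1.
  move/le_trans; apply; rewrite mulrAC ler_pM//.
  - by rewrite mulr_ge0// invr_ge0 subr_ge0 ltW.
  - exact: modulus_ge0.
  - rewrite ler_wpM2l// lef_pV2 ?posrE ?subr_gt0// lerB//.
    by rewrite modulusM ler_piMr ?modulus_ge0// modulusX exprn_ile1// ltW.
  - by rewrite modulusM ler_piMl ?modulus_ge0// ltW.
have -> : qpochoo q (a * y) / qpochoo q y = F y; last exact: SF.
apply: (mulIf (qpochoo_small_neq0 y1)); rewrite divfK ?qpochoo_small_neq0//.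
apply: (cvg_Cx_unique (u := fun n => qpoch q y n * F y)).
  rewrite (funext Fiter) -[qpochoo q (a * y)]mulr1.
  by apply: cvgM_num; [exact: cvg_qpoch|exact: F1].
by rewrite mulrC; apply: cvgM_num; [exact: cvg_qpoch|exact: cvg_cst].
Qed.

End QPochhammer.

(** * Exchanging the two summations *)

Section Exchange.
Variable R : realType.
Implicit Types (e A B F : nat -> Cx R) (p q S : Cx R).

(** A diagonal argument: the error bound is uniform in L, so the limits in J and
   in L may be taken in either order. *)
Lemma cvg_uniform_approx (u : nat -> Cx R) (P : nat -> nat -> Cx R)
    (s : nat -> Cx R) (S : Cx R) (delta : nat -> R) :
  delta @ \oo --> (0 : R) ->
  (forall J L, modulus (u L - P J L) <= delta J) ->
  (forall J, P J @ \oo --> s J) ->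
  s @ \oo --> S -> u @ \oo --> S.
Proof.
move=> /cvgrPdist_lt hd huP hP /cvg_modulusP/cvgrPdist_lt hs.
apply/cvg_modulusP/cvgrPdist_lt => eps eps0.
have eps3 : 0 < eps / 3 by rewrite divr_gt0.
have [J1 _ hJ1] := hd _ eps3; have [J2 _ hJ2] := hs _ eps3.
pose J := maxn J1 J2.
have {hJ1} dJ : delta J < eps / 3.
  have := hJ1 J (leq_maxl _ _); rewrite sub0r normrN.
  exact/le_lt_trans/ler_norm.
have {hJ2} sJ : modulus (S - s J) < eps / 3.
  have := hJ2 J (leq_maxr _ _).
  by rewrite sub0r normrN ger0_norm ?modulus_ge0.
have /cvg_modulusP/cvgrPdist_lt/(_ _ eps3) := hP J.
apply: filterS => L.
rewrite !sub0r !normrN !ger0_norm ?modulus_ge0// => sP.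
have -> : S - u L = (S - s J) + ((s J - P J L) + (P J L - u L)) by ring.
apply: le_lt_trans (ler_modulusD _ _) _.
have h1 := ler_modulusD (s J - P J L) (P J L - u L).
have := huP J L; rewrite modulus_distC => h2.
by lra.
Qed.

(** For |p| < 1 the inner sums converge absolutely for j >= 1 but perhaps only
   conditionally for j = 0.  Truncating the sum over j after the term j = J
   leaves an error which is geometric in both J and l, hence uniform in the
   truncation of the sum over l. *)
Lemma exchange_sums_small p q e A B F S (M C : R) :
  modulus p < 1 -> modulus q < 1 ->
  (forall l, modulus (e l) <= M) -> (forall j, modulus (A j) <= C) ->
  (forall j, series (fun l => e l * (q ^+ j) ^+ l) @ \oo --> F j) ->
  series (fun j => A j * p ^+ j * F j) @ \oo --> S ->
  (forall l, series (fun j => A j * (p * q ^+ l) ^+ j) @ \oo --> B l) ->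
  series (fun l => e l * B l) @ \oo --> S.
Proof.
move=> p1 q1 eM AC hF hS hB.
have M0 : 0 <= M := le_trans (modulus_ge0 _) (eM 0%N).
have C0 : 0 <= C := le_trans (modulus_ge0 _) (AC 0%N).
have pg : 0 < 1 - modulus p by rewrite subr_gt0.
have qg : 0 < 1 - modulus q by rewrite subr_gt0.
pose K := M * C / (1 - modulus p) / (1 - modulus q).
(* The term j = 0 is always kept: bounding |q ^ l| ^ j by |q| ^ l requires
   j >= 1. *)
pose P J L := \sum_(0 <= l < L)
  (e l * \sum_(0 <= j < J.+1) A j * (p * q ^+ l) ^+ j).
apply: (@cvg_uniform_approx _ P
  (fun J => series (fun j => A j * p ^+ j * F j) J.+1) S
  (fun J => K * modulus (0 - p ^+ J.+1))).
- rewrite -(mulr0 K); apply: cvgMl_num.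
  by apply/cvg_modulusP; apply: cvgS_num; exact: cvg_expr_small.
- move=> J L; rewrite sub0r modulusN modulusX /P /series /= -sumrB.
  apply: le_trans (modulus_sum _ _ _) _.
  have hl l : modulus (e l * B l - e l * \sum_(0 <= j < J.+1)
        A j * (p * q ^+ l) ^+ j) <=
      M * C / (1 - modulus p) * modulus p ^+ J.+1 * modulus q ^+ l.
    have ql1 : modulus (q ^+ l) <= 1.
      by rewrite modulusX exprn_ile1 ?modulus_ge0// ltW.
    have ple : modulus (p * q ^+ l) <= modulus p.
      by rewrite modulusM ler_piMr ?modulus_ge0.
    have pl1 : modulus (p * q ^+ l) < 1 by apply: le_lt_trans p1.
    rewrite -mulrBr modulusM.
    have Ale j : modulus (A j * (p * q ^+ l) ^+ j) <=
        C * modulus (p * q ^+ l) ^+ j.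
      by rewrite modulusM modulusX ler_wpM2r// exprn_ge0// modulus_ge0.
    have ht := series_tail_geometric J.+1 (modulus_ge0 _) pl1 Ale (hB l).
    have hX : modulus (p * q ^+ l) ^+ J.+1 <=
        modulus p ^+ J.+1 * modulus q ^+ l.
      rewrite modulusM exprMn ler_wpM2l ?exprn_ge0 ?modulus_ge0//.
      by rewrite exprS modulusX ler_piMr ?exprn_ge0 ?modulus_ge0//
        exprn_ile1 ?exprn_ge0 ?modulus_ge0// -modulusX.
    have hV : (1 - modulus (p * q ^+ l))^-1 <= (1 - modulus p)^-1.
      by rewrite lef_pV2 ?posrE ?subr_gt0// lerB.
    have -> : M * C / (1 - modulus p) * modulus p ^+ J.+1 * modulus q ^+ l =
      M * (C * (modulus p ^+ J.+1 * modulus q ^+ l) / (1 - modulus p)) by ring.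
    apply: ler_pM; rewrite ?modulus_ge0//.
    apply: le_trans ht _; apply: ler_pM => //.
    + by rewrite mulr_ge0 ?exprn_ge0 ?modulus_ge0.
    + by rewrite invr_ge0 subr_ge0 ltW.
    + by rewrite ler_wpM2l.
  apply: le_trans (ler_sum _ (fun l _ => hl l)) _.
  rewrite -mulr_sumr /K [leRHS]mulrAC ler_wpM2l//.
    rewrite mulr_ge0 ?exprn_ge0 ?modulus_ge0// mulr_ge0// ?mulr_ge0//.
    by rewrite invr_ge0 ltW.
  by rewrite big_mkord geometric_sum_le ?modulus_ge0.
- move=> J; have -> : P J = (fun L => \sum_(0 <= j < J.+1)
      A j * p ^+ j * series (fun l => e l * (q ^+ j) ^+ l) L).
    apply/funext => L; rewrite /P /series /=.
    under eq_bigr do rewrite mulr_sumr.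
    rewrite exchange_big /=; apply: eq_bigr => j _.
    rewrite mulr_sumr; apply: eq_bigr => l _.
    by rewrite exprMn -!exprM mulnC; ring.
  have h := cvg_sum_num (c := fun j => A j * p ^+ j) (n := J.+1) hF.
  exact: h.
- by apply: cvgS_num.
Qed.

(** If e vanishes before the rank m and not at m, then F j is equivalent to
   e m * q ^ (m j) as j grows, so that the convergence of the outer sum forces
   |p q ^ m| < 1; after a shift by m the sums can be exchanged. *)
Lemma exchange_sums p q e A Ainf B F S :
  q != 0 -> modulus q < 1 -> A @ \oo --> Ainf -> Ainf != 0 ->
  (forall j, series (fun l => e l * (q ^+ j) ^+ l) @ \oo --> F j) ->
  series (fun j => A j * p ^+ j * F j) @ \oo --> S ->
  (forall l, modulus (p * q ^+ l) < 1 ->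
     series (fun j => A j * (p * q ^+ l) ^+ j) @ \oo --> B l) ->
  series (fun l => e l * B l) @ \oo --> S.
Proof.
move=> q0 q1 hA A0 hF hS hB.
have [C C0 AC] := cvg_modulus_bounded hA.
have [M M0 eM] : exists2 M : R, 0 <= M & forall l, modulus (e l) <= M.
  have /cvg_series_to0 := hF 0%N.
  under eq_fun do rewrite expr0 expr1n mulr1.
  exact: cvg_modulus_bounded.
have hshift m j : (forall l, (l < m)%N -> e l = 0) ->
    series (fun l => e (m + l)%N * (q ^+ j) ^+ l) @ \oo -->
      ((q ^+ j) ^+ m)^-1 * F j.
  move=> em; have qj : (q ^+ j) ^+ m != 0 by rewrite !expf_neq0.
  have -> : (fun l => e (m + l)%N * (q ^+ j) ^+ l) = (fun l =>
      ((q ^+ j) ^+ m)^-1 * (e (m + l)%N * (q ^+ j) ^+ (m + l))).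
    by apply/funext => l; rewrite exprD [in RHS]mulrCA mulKf.
  apply: cvg_series_scale.
  rewrite (_ : series _ = fun n =>
      series (fun l => e l * (q ^+ j) ^+ l) (m + n)).
    by apply: cvg_addn; exact: hF.
  by apply/funext => n; rewrite series_skip// => l /em ->; rewrite mul0r.
have [[m0 em0]|e0] := pselect (exists l, e l != 0); last first.
  have {}e0 l : e l = 0 by apply/eqP/negPn/negP => el; apply: e0; exists l.
  have F0 j : F j = 0.
    apply: (cvg_Cx_unique (hF j)); apply: cvg_series0 => l.
    by rewrite e0 mul0r.
  have -> : S = 0.
    by apply: (cvg_Cx_unique hS); apply: cvg_series0 => j; rewrite F0 mulr0.
  by apply: cvg_series0 => l; rewrite e0 mul0r.
have [m em mmin] : exists2 m, e m != 0 & forall l, (l < m)%N -> e l = 0.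
  have ex : exists l, e l != 0 by exists m0.
  exists (ex_minn ex); case: ex_minnP => // m _ hm l.
  by apply: contraTeq => /hm; rewrite -leqNgt.
pose F' j := ((q ^+ j) ^+ m)^-1 * F j.
have hF' j : series (fun l => e (m + l)%N * (q ^+ j) ^+ l) @ \oo --> F' j.
  exact: hshift.
have hT : series (fun j => A j * (p * q ^+ m) ^+ j * F' j) @ \oo --> S.
  rewrite (_ : (fun j => A j * _ * _) = fun j => A j * p ^+ j * F j)//.
  apply/funext => j; rewrite /F' exprMn -!exprM [(j * m)%N]mulnC.
  by rewrite -!mulrA mulVKf// expf_neq0.
(* F' tends to e m, whereas the general term of the outer series tends to 0. *)
have p1 : modulus (p * q ^+ m) < 1.
  have F'm : F' @ \oo --> e m.
    apply: (@cvg_addn_inv _ 1); apply/cvg_modulusP.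
    have h0 : (fun j => M / (1 - modulus q) * modulus (0 - q ^+ j.+1)) @ \oo
        --> (0 : R).
      rewrite -(mulr0 (M / (1 - modulus q))).
      by apply: cvgMl_num; apply/cvg_modulusP/cvgS_num; exact: cvg_expr_small.
    apply: (squeeze_cvgr _ (cvg_cst 0) h0); apply: nearW => j.
    rewrite modulus_ge0 /= sub0r modulusN modulus_distC add1n.
    have qj : modulus (q ^+ j.+1) <= modulus q.
      rewrite exprS modulusM ler_piMr ?modulus_ge0// modulusX.
      by rewrite exprn_ile1 ?modulus_ge0// ltW.
    have qj1 : modulus (q ^+ j.+1) < 1 by apply: le_lt_trans q1.
    have ble l : modulus (e (m + l)%N * (q ^+ j.+1) ^+ l) <=
        M * modulus (q ^+ j.+1) ^+ l.
      by rewrite modulusM modulusX ler_wpM2r ?exprn_ge0 ?modulus_ge0.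
    have := series_tail_geometric 1 (modulus_ge0 _) qj1 ble (hF' j.+1).
    rewrite {1}/series /= big_nat1 expr0 mulr1 addn0 expr1 => /le_trans; apply.
    rewrite mulrAC ler_wpM2r ?modulus_ge0// ler_wpM2l//.
    by rewrite lef_pV2 ?posrE ?subr_gt0// lerB.
  rewrite ltNge; apply/negP => p1.
  have AF0 : (fun j => A j * F' j) @ \oo --> (0 : Cx R).
    apply/cvg_modulusP.
    have /cvg_modulusP hT0 := cvg_series_to0 hT.
    apply: (squeeze_cvgr _ (cvg_cst 0) hT0); apply: nearW => j.
    rewrite modulus_ge0 !sub0r !modulusN [A j * _ * _]mulrAC.
    rewrite [leRHS]modulusM modulusX.
    by rewrite ler_peMr ?modulus_ge0// exprn_ege1.
  have := cvg_Cx_unique AF0 (cvgM_num hA F'm) => /esym/eqP.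
  by rewrite mulf_eq0 (negbTE A0) (negbTE em).
have h0 l : (l < m)%N -> e l * B l = 0 by move=> /mmin ->; rewrite mul0r.
apply: (@cvg_addn_inv _ m).
under eq_fun do rewrite series_skip//.
apply: (exchange_sums_small (e := fun l => e (m + l)%N)
         (B := fun l => B (m + l)%N) p1 q1 (fun l => eM _) AC hF' hT) => l.
rewrite -mulrA -exprD; apply: hB.
rewrite exprD mulrA modulusM (le_lt_trans _ p1)// ler_piMr ?modulus_ge0//.
by rewrite modulusX exprn_ile1 ?modulus_ge0// ltW.
Qed.
End Exchange.

(** * The fractional q-integral of a series in 1 / x *)

Section Kober.
Variables (R : realType) (q : Cx R) (lg : Cx R -> Cx R).
Hypotheses (q_neq0 : q != 0) (q_lt1 : modulus q < 1) (hlg : is_qlog q lg).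
Implicit Types (x y z w mu nu : Cx R) (c d : nat -> Cx R) (f g : Cx R -> Cx R).

Local Notation pow := (cpow lg).

Lemma cpowD x y z : pow x (y + z) = pow x y * pow x z.
Proof. by rewrite /cpow mulrDl cexpD. Qed.

Lemma cpow0 x : pow x 0 = 1.
Proof. by rewrite /cpow mul0r cexp0. Qed.

Lemma cpow_neq0 x y : pow x y != 0.
Proof.
apply/negP => /eqP h; have := cpow0 x.
by rewrite -(subrr y) cpowD h mul0r => /esym/eqP; rewrite oner_eq0.
Qed.

Lemma cpowN x y : pow x (- y) = (pow x y)^-1.
Proof.
apply: (mulIf (cpow_neq0 x y)).
by rewrite mulVf ?cpow_neq0// -cpowD addNr cpow0.
Qed.

Lemma cpow1 x : x != 0 -> pow x 1 = x.
Proof. by move=> x0; rewrite /cpow mul1r; case: hlg => ->. Qed.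

Lemma cpow_nat x n : x != 0 -> pow x n%:R = x ^+ n.
Proof.
move=> x0; elim: n => [|n IH]; first by rewrite cpow0.
by rewrite -natr1 cpowD IH cpow1// exprSr.
Qed.

(** Coherence of the branch along the lattice x q^Z; it makes all the powers of
   the Jackson sum geometric. *)
Lemma lgV x n : x != 0 -> lg (x * q ^- n) = lg x - n%:R * lg q.
Proof.
move=> x0; elim: n => [|n IH]; first by rewrite expr0 invr1 mulr1 mul0r subr0.
have h : x * q ^- n.+1 != 0 by rewrite mulf_neq0// invr_eq0 expf_neq0.
have e : x * q ^- n.+1 * q = x * q ^- n.
  by rewrite exprSr; field; rewrite q_neq0 expf_neq0.
have := proj2 hlg _ h; rewrite e IH => e'.
by apply: (addIr (lg q)); rewrite -e' -natr1; ring.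
Qed.

Lemma cpow_lattice x y n : x != 0 ->
  pow (x * q ^- n) y = pow x y * pow q y ^- n.
Proof.
move=> x0; rewrite {1}/cpow lgV// mulrBr cexpD -/(cpow lg x y); congr (_ * _).
have -> : - (y * (n%:R * lg q)) = (- (n%:R * y)) * lg q by ring.
rewrite -/(cpow lg q _) cpowN; congr (_^-1).
elim: n => [|n IH]; first by rewrite mul0r cpow0.
by rewrite -natr1 mulrDl mul1r cpowD IH exprSr.
Qed.

Lemma one_subq_neq0 : 1 - q != 0.
Proof.
by rewrite subr_eq0; apply: contraTneq q_lt1 => <-; rewrite modulus1 ltxx.
Qed.

(** The factors (q;q)_oo cancel and the powers of 1 - q combine to
   (1 - q)^mu, so the quotient is finite and nonzero away from the poles. *)
Lemma qGamma_ratio nu mu :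
  (forall l, pow q nu * q ^+ l != 1) ->
  qGamma q lg nu / qGamma q lg (nu + mu) =
  qpochoo q (pow q (nu + mu)) / qpochoo q (pow q nu) * pow (1 - q) mu.
Proof.
move=> hnu; rewrite /qGamma.
have qq : qpochoo q q != 0 by exact: qpochoo_small_neq0.
have -> : pow (1 - q) (1 - nu) = pow (1 - q) (1 - (nu + mu)) * pow (1 - q) mu.
  by rewrite -cpowD; congr (pow _ _); ring.
have := cpow_neq0 (1 - q) (1 - (nu + mu)).
move: (pow (1 - q) _) => X X0.
rewrite !invfM !invrK; set Y := pow _ mu.
have -> : qpochoo q q / qpochoo q (pow q nu) * (X * Y) *
   ((qpochoo q q)^-1 * qpochoo q (pow q (nu + mu)) / X) =
   (qpochoo q q / qpochoo q q) * (X / X) *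
   (qpochoo q (pow q (nu + mu)) / qpochoo q (pow q nu) * Y) by ring.
by rewrite !divff// !mul1r.
Qed.

Lemma qGamma_ratio_neq0 nu mu :
  (forall l, pow q nu * q ^+ l != 1) ->
  (forall l, pow q (nu + mu) * q ^+ l != 1) ->
  qGamma q lg nu / qGamma q lg (nu + mu) != 0.
Proof.
move=> hnu hnumu; rewrite qGamma_ratio// !mulf_neq0 ?cpow_neq0//.
  exact/qpochoo_neq0P.
by rewrite invr_eq0; exact/qpochoo_neq0P.
Qed.

(** With the shift of index k >= 1 to k + 1, the quotient
   (q^(k+1))_oo / (q^(k + mu))_oo is a constant times the q-binomial coefficient
   with parameter q^mu, and the argument of f becomes 1 / (w q^k) for
   w = q^mu / x. *)
Lemma jackson_term_koberE nu mu f x k :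
  x != 0 -> (forall l, pow q mu * q ^+ l != 1) ->
  jackson_term q (kober_integrand q lg nu mu f x) x k =
  qpochoo q q / qpochoo q (pow q mu) * pow x (- nu - 1) * pow q nu *
  (qbin_coef q (pow q mu) k * pow q nu ^+ k *
   f (1 / (1 / x * pow q mu * q ^+ k))).
Proof.
move=> x0 hmu; rewrite /jackson_term /kober_integrand /qpochc.
have qk n : q ^+ n != 0 by rewrite expf_neq0.
have -> : x / (x * q ^- k.+1) = q ^+ k.+1.
  by rewrite invfM invrK mulrA divff// mul1r.
have -> : q ^+ k.+1 * pow q (mu - 1) = pow q mu * q ^+ k.
  by rewrite cpowD cpowN cpow1// exprS; field.
have -> : x * q ^- k.+1 * pow q (1 - mu) = 1 / (1 / x * pow q mu * q ^+ k).
  rewrite cpowD cpowN cpow1// exprS; field.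
  by rewrite cpow_neq0 x0 qk q_neq0.
rewrite cpow_lattice//.
have -> : pow q (- nu - 1) ^- k.+1 = pow q nu ^+ k.+1 * q ^+ k.+1.
  by rewrite -opprD cpowN exprVn invrK cpowD cpow1// exprMn.
rewrite /qbin_coef (qpochoo_split q_lt1 q k) -exprS.
rewrite (qpochoo_split q_lt1 (pow q mu) k).
have h1 : qpoch q (pow q mu) k != 0 by exact: qpoch_neq0.
have h2 : qpochoo q (pow q mu * q ^+ k) != 0.
  by apply/qpochoo_neq0P => // l; rewrite -mulrA -exprD.
have h3 : qpoch q q k != 0.
  by apply: qpoch_neq0; apply/qpochoo_neq0P => //; exact: qpochoo_small_neq0.
move: (f _) (qk k.+1) => F qk1; rewrite [pow q nu ^+ k.+1]exprS; field.
by rewrite h1 h2 h3 qk1.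
Qed.

(** The definedness of the integral supplies both conditions that bear on the
   parameters: the denominators of the kernel give q^mu q^l != 1 for all l, and
   the convergence of the Jackson sum gives |q^nu q^l| < 1 wherever c l != 0,
   which is when the q-binomial theorem applies. *)
Lemma koberK_series c nu mu f x :
  x != 0 ->
  (forall l, pow q nu * q ^+ l != 1) ->
  (forall l, pow q (nu + mu) * q ^+ l != 1) ->
  (forall y, f y = limn (series (fun l => c l * (1 / y) ^+ l))) ->
  koberK_defined q lg nu mu
    [set y | y != 0 /\ cvgn (series (fun l => c l * (1 / y) ^+ l))] f x ->
  series (fun l => c l * (qpoch q (pow q nu) l / qpoch q (pow q (nu + mu)) l) *
                   (1 / x * pow q mu) ^+ l) @ \oo -->
  koberK q lg nu mu f x / (qGamma q lg nu / qGamma q lg (nu + mu)).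
Proof.
move=> x0 hnu hnumu hf [hD hker hJ].
set w := 1 / x * pow q mu.
have qk n : q ^+ n != 0 by rewrite expf_neq0.
have w0 : w != 0 by rewrite !mulf_neq0 ?oner_eq0 ?invr_eq0 ?cpow_neq0.
have qmu0 : qpochoo q (pow q mu) != 0.
  have := hker 0%N; rewrite expr1 invfM invrK mulrA divff// mul1r.
  by rewrite cpowD cpowN cpow1// mulrCA divff// mulr1.
have hmu : forall l, pow q mu * q ^+ l != 1 by apply/qpochoo_neq0P.
pose F k := f (1 / (w * q ^+ k)).
have hF k : series (fun l => c l * w ^+ l * (q ^+ k) ^+ l) @ \oo --> F k.
  have [_ hk] := hD k.
  have e : x * q ^- k.+1 * pow q (1 - mu) = 1 / (w * q ^+ k).
    rewrite /w cpowD cpowN cpow1// exprS; field.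
    by rewrite cpow_neq0 x0 qk q_neq0.
  rewrite e in hk; rewrite /F hf.
  suff -> : (fun l => c l * w ^+ l * (q ^+ k) ^+ l) =
            (fun l => c l * (1 / (1 / (w * q ^+ k))) ^+ l) by exact: hk.
  by apply/funext => l; rewrite -mulrA -exprMn !div1r invrK.
set A := qbin_coef q (pow q mu).
set c1 := qpochoo q q / qpochoo q (pow q mu) * pow x (- nu - 1) * pow q nu.
have qq : qpochoo q q != 0 by exact: qpochoo_small_neq0.
have c10 : c1 != 0 by rewrite !mulf_neq0 ?invr_eq0 ?cpow_neq0.
have termE : jackson_term q (kober_integrand q lg nu mu f x) x =
    (fun k => c1 * (A k * pow q nu ^+ k * F k)).
  by apply/funext => k; rewrite jackson_term_koberE.
pose L := limn (series (jackson_term q (kober_integrand q lg nu mu f x) x)).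
have hL :
    series (jackson_term q (kober_integrand q lg nu mu f x) x) @ \oo --> L.
  exact: hJ.
have hS : series (fun k => A k * pow q nu ^+ k * F k) @ \oo --> c1^-1 * L.
  rewrite (_ : (fun k => _) = (fun k => c1^-1 *
    jackson_term q (kober_integrand q lg nu mu f x) x k)).
    by apply: cvg_series_scale; exact: hL.
  by apply/funext => k; rewrite termE mulKf.
have KE : koberK q lg nu mu f x = pow (1 - q) mu * (c1^-1 * L).
  rewrite /koberK /jackson -/L {1}/qGamma cpowN.
  have -> : pow (1 - q) mu = (1 - q) / pow (1 - q) (1 - mu).
    by rewrite cpowD cpowN cpow1 ?one_subq_neq0//; field;
      rewrite cpow_neq0 one_subq_neq0.
  rewrite -[in LHS](mulVKf c10 L); move: (c1^-1 * L) => T.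
  rewrite /c1 [pow x (- nu - 1)]cpowD !cpowN cpow1//; field.
  by rewrite qq qmu0 x0 !cpow_neq0.
pose B l := qpochoo q (pow q (nu + mu)) / qpochoo q (pow q nu) *
   (qpoch q (pow q nu) l / qpoch q (pow q (nu + mu)) l).
have hB l : modulus (pow q nu * q ^+ l) < 1 ->
    series (fun j => A j * (pow q nu * q ^+ l) ^+ j) @ \oo --> B l.
  move=> /(qbinomial q_lt1 (a := pow q mu)).
  suff -> : B l = qpochoo q (pow q mu * (pow q nu * q ^+ l)) /
                  qpochoo q (pow q nu * q ^+ l) by [].
  have -> : pow q mu * (pow q nu * q ^+ l) = pow q (nu + mu) * q ^+ l.
    by rewrite mulrA -cpowD [mu + nu]addrC.
  rewrite /B (qpochoo_split q_lt1 (pow q (nu + mu)) l).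
  rewrite (qpochoo_split q_lt1 (pow q nu) l).
  have h1 : qpoch q (pow q nu) l != 0 by exact: qpoch_neq0.
  have h2 : qpoch q (pow q (nu + mu)) l != 0 by exact: qpoch_neq0.
  have h3 : qpochoo q (pow q nu * q ^+ l) != 0.
    by apply/qpochoo_neq0P => // i; rewrite -mulrA -exprD.
  by field; rewrite h1 h2 h3.
have A0 : qpochoo q (pow q mu) / qpochoo q q != 0.
  by rewrite mulf_neq0// invr_eq0.
have := exchange_sums q_neq0 q_lt1 (cvg_qbin_coef q_lt1 (a := pow q mu)) A0
  hF hS hB.
set G := qpochoo q (pow q (nu + mu)) / qpochoo q (pow q nu).
have G0 : G != 0.
  by rewrite mulf_neq0 ?invr_eq0//; apply/qpochoo_neq0P.
move=> h; have {h} := cvg_series_scale (c := G^-1) h.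
have -> : koberK q lg nu mu f x / (qGamma q lg nu / qGamma q lg (nu + mu)) =
    G^-1 * (c1^-1 * L).
  rewrite (qGamma_ratio _ hnu) -/G KE; move: (c1^-1 * L) => T.
  by field; rewrite G0 cpow_neq0.
suff -> : (fun l => G^-1 * (c l * w ^+ l * B l)) =
  (fun l => c l * (qpoch q (pow q nu) l / qpoch q (pow q (nu + mu)) l) * w ^+ l)
  by [].
apply/funext => l; rewrite /B -/G.
by rewrite mulrCA mulKf// mulrAC.
Qed.

End Kober.

(** * The fractional q-derivative *)

Section KoberDerivative.
Variables (R : realType) (q : Cx R) (lg : Cx R -> Cx R).
Hypotheses (q_neq0 : q != 0) (q_lt1 : modulus q < 1) (hlg : is_qlog q lg).
Implicit Types (x y z w mu nu : Cx R) (c d : nat -> Cx R) (f g : Cx R -> Cx R).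

Local Notation pow := (cpow lg).

(** In this form each factor needs f only at x and at q x, so that n factors
   reach x, x q, ..., x q^n. *)
Lemma kober_factorE lam f x : x != 0 ->
  kober_factor q lg lam f x = (1 - q)^-1 * (f (q * x) - pow q lam * f x).
Proof.
move=> x0; rewrite /kober_factor /qnum /qderiv; field.
by rewrite x0 one_subq_neq0.
Qed.

(** Termwise, f |-> (f(q x) - q^lambda f(x)) / (1 - q) multiplies x^(- l) by
   (q^(- l) - q^lambda) / (1 - q). *)
Lemma kober_factors_series n (lam : nat -> Cx R) d g x :
  x != 0 ->
  (forall j, (j <= n)%N ->
    series (fun l => d l * (1 / (x * q ^+ j)) ^+ l) @ \oo --> g (x * q ^+ j)) ->
  series (fun l => d l * \prod_(i < n) ((q ^- l - pow q (lam i)) / (1 - q)) *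
                   (1 / x) ^+ l) @ \oo -->
  (\big[comp/id]_(i < n) kober_factor q lg (lam i)) g x.
Proof.
elim: n lam x => [|n IH] lam x x0 hg.
  rewrite big_ord0 /=; have := hg 0%N isT; rewrite expr0 mulr1.
  suff -> : (fun l => d l * \prod_(i < 0) ((q ^- l - pow q (lam i)) / (1 - q)) *
      (1 / x) ^+ l) = (fun l => d l * (1 / x) ^+ l) by [].
  by apply/funext => l; rewrite big_ord0 mulr1.
rewrite big_ord_recl /= kober_factorE// [q * x]mulrC.
pose lam' i := lam i.+1.
have hx := IH lam' x x0 (fun j jn => hg j (leqW jn)).
have xq0 : x * q != 0 by rewrite mulf_neq0.
have hxq : series (fun l => d l * \prod_(i < n) ((q ^- l - pow q (lam' i)) /
    (1 - q)) * (1 / (x * q)) ^+ l) @ \oo -->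
    (\big[comp/id]_(i < n) kober_factor q lg (lam' i)) g (x * q).
  apply: (IH lam' _ xq0) => j jn.
  have -> : x * q * q ^+ j = x * q ^+ j.+1 by rewrite exprS mulrA.
  exact: (hg j.+1 jn).
have h1 := cvg_series_scale (c := pow q (lam 0%N)) hx.
have h2 := cvg_seriesB hxq h1.
have h3 := cvg_series_scale (c := (1 - q)^-1) h2.
apply: (cvg_series_eq _ h3) => l; rewrite big_ord_recl /=.
under [X in _ = _ * (_ * X) * _]eq_bigr do rewrite /bump /= add1n.
move: (\prod_(i < n) _) => P; rewrite !div1r invfM exprMn !exprVn; ring.
Qed.

Lemma qGamma_addn nu m :
  (forall l, pow q nu * q ^+ l != 1) ->
  qGamma q lg (nu + m%:R) =
  qGamma q lg nu * qpoch q (pow q nu) m / (1 - q) ^+ m.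
Proof.
move=> hnu; rewrite /qGamma.
have -> : pow (1 - q) (1 - nu) = pow (1 - q) (1 - (nu + m%:R)) * (1 - q) ^+ m.
  by rewrite -(cpow_nat hlg) ?one_subq_neq0// -cpowD; congr (pow _ _); ring.
have -> : pow q (nu + m%:R) = pow q nu * q ^+ m.
  by rewrite cpowD (cpow_nat hlg).
rewrite (qpochoo_split q_lt1 (pow q nu) m).
have h1 : qpoch q (pow q nu) m != 0 by exact: qpoch_neq0.
have h2 : qpochoo q (pow q nu * q ^+ m) != 0.
  by apply/qpochoo_neq0P => // i; rewrite -mulrA -exprD.
have h3 : (1 - q) ^+ m != 0 by rewrite expf_neq0// one_subq_neq0.
by move: (pow (1 - q) _) => X; field; rewrite h1 h2 h3.
Qed.

Lemma prod_kober_factor nu m l :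
  \prod_(i < m) ((q ^- l - pow q (nu + i%:R)) / (1 - q)) =
  q ^- l ^+ m * qpoch q (pow q nu * q ^+ l) m / (1 - q) ^+ m.
Proof.
have ql : q ^+ l != 0 by rewrite expf_neq0.
elim: m => [|m IH].
  by rewrite big_ord0 !expr0 qpoch0 divr1 mulr1.
rewrite big_ord_recr /= IH qpochS cpowD (cpow_nat hlg)// !exprS.
have h : (1 - q) ^+ m != 0 by rewrite expf_neq0// one_subq_neq0.
by field; rewrite h (one_subq_neq0 q_lt1) ql.
Qed.

(** Two identities drive the simplification: (q^nu)_(m + l) split at m and at l,
   which trades (q^(nu + m))_l for (q^nu)_l, and
   q^((m - mu) l) q^(- l m) = q^(- mu l).  The Gamma factor follows the first
   of them through [qGamma_addn]. *)
Lemma koberD_series c nu mu f x :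
  x != 0 ->
  (forall l, pow q nu * q ^+ l != 1) ->
  (forall l, pow q (nu + mu) * q ^+ l != 1) ->
  (forall y, f y = limn (series (fun l => c l * (1 / y) ^+ l))) ->
  koberD_defined q lg nu mu
    [set y | y != 0 /\ cvgn (series (fun l => c l * (1 / y) ^+ l))] f x ->
  series (fun l => c l * (qpoch q (pow q (nu + mu)) l / qpoch q (pow q nu) l) *
                   (1 / x * pow q (- mu)) ^+ l) @ \oo -->
  koberD q lg nu mu f x / (qGamma q lg (nu + mu) / qGamma q lg nu).
Proof.
move=> x0 hnu hnumu hf hD; rewrite /koberD.
move: hD; rewrite /koberD_defined; move: (kober_order mu) => m hD.
have numE : nu + mu + (m%:R - mu) = nu + m%:R by ring.
have powm : pow q (nu + m%:R) = pow q nu * q ^+ m.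
  by rewrite cpowD (cpow_nat hlg).
have hnum l : pow q (nu + m%:R) * q ^+ l != 1.
  by rewrite powm -mulrA -exprD.
pose r := qGamma q lg (nu + mu) / qGamma q lg (nu + m%:R).
have r0 : r != 0.
  by rewrite /r -numE qGamma_ratio_neq0// => l; rewrite numE.
pose g := koberK q lg (nu + mu) (m%:R - mu) f.
pose d l := r * (c l * (qpoch q (pow q (nu + mu)) l /
                   qpoch q (pow q (nu + m%:R)) l) * pow q (m%:R - mu) ^+ l).
have hg j : (j <= m)%N ->
    series (fun l => d l * (1 / (x * q ^+ j)) ^+ l) @ \oo --> g (x * q ^+ j).
  move=> jm; have xj0 : x * q ^+ j != 0 by rewrite mulf_neq0// expf_neq0.
  have := koberK_series q_neq0 q_lt1 hlg xj0 hnumu _ hf (hD j jm).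
  rewrite numE -/r -/g => /(_ hnum) h.
  have {h} := cvg_series_scale (c := r) h.
  rewrite [r * (_ / r)]mulrC divfK//; apply: cvg_series_eq => l.
  by rewrite [(_ * pow _ _) ^+ l]exprMn /d; ring.
have h := kober_factors_series (n := m) (lam := fun i => nu + i%:R) x0 hg.
have {h} := cvg_series_scale
  (c := (qGamma q lg (nu + mu) / qGamma q lg nu)^-1) h.
rewrite [_^-1 * _]mulrC; apply: cvg_series_eq => l.
rewrite prod_kober_factor /d.
have rE : r = qGamma q lg (nu + mu) / qGamma q lg nu * (1 - q) ^+ m /
    qpoch q (pow q nu) m.
  rewrite /r qGamma_addn//; move: (qGamma q lg nu) (qGamma q lg (nu + mu)).
  by move=> G G'; rewrite invfM invrK invfM; ring.
have h1 : qpoch q (pow q nu) m != 0 by exact: qpoch_neq0.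
have h2 : qpoch q (pow q nu) l != 0 by exact: qpoch_neq0.
have h3 : qpoch q (pow q (nu + m%:R)) l != 0 by exact: qpoch_neq0.
have h4 : (1 - q) ^+ m != 0 by rewrite expf_neq0// one_subq_neq0.
have G0 : qGamma q lg (nu + mu) / qGamma q lg nu != 0.
  by apply: contra_neq r0 => G0; rewrite rE G0 !mul0r.
have pochE : qpoch q (pow q nu * q ^+ l) m =
    qpoch q (pow q nu) m * qpoch q (pow q (nu + m%:R)) l / qpoch q (pow q nu) l.
  by rewrite powm -qpochD addnC qpochD [RHS]mulrAC divff// mul1r.
have powE : pow q (m%:R - mu) ^+ l * q ^- l ^+ m = pow q (- mu) ^+ l.
  rewrite cpowD (cpow_nat hlg)// exprMn -!exprVn -!exprM mulrAC mulnC exprVn.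
  by rewrite divff ?expf_neq0// mul1r.
rewrite [(_ * pow q (- mu)) ^+ l]exprMn -powE pochE rE.
move: (qGamma _ _ _ / _) G0 => G G0.
field.
by rewrite G0 h1 h2 h3 h4.
Qed.

End KoberDerivative.

(** * The basic function R as a power series *)

Section BasicFunction.
Variables (R : realType) (q : Cx R) (lg : Cx R -> Cx R).
Implicit Types (alpha beta x y z : Cx R).

(** Taking the term at z = 1 as the coefficient of z^l exhibits the basic
   function as a power series. *)
Lemma qR_term_powerE r s (a : r.-tuple (Cx R)) (b : s.-tuple (Cx R))
    alpha beta z l :
  qR_term q lg a b alpha beta z l = qR_term q lg a b alpha beta 1 l * z ^+ l.
Proof. by rewrite /qR_term expr1n; ring. Qed.

(** One more parameter on each side leaves the exponent 1 + s - r unchanged. *)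
Lemma qR_term_rcons r s (a : r.-tuple (Cx R)) (b : s.-tuple (Cx R))
    alpha beta x y z l :
  qR_term q lg (rcons_tuple a x) (rcons_tuple b y) alpha beta z l =
  qR_term q lg a b alpha beta 1 l * (qpoch q x l / qpoch q y l) * z ^+ l.
Proof.
rewrite qR_term_powerE; congr (_ * _); rewrite /qR_term /=.
have -> : 1 + s.+1%:Z - r.+1%:Z = 1 + s%:Z - r%:Z :> int.
  by rewrite (intS s) (intS r) opprD addrACA subrr add0r.
rewrite -!cats1 !big_cat /= !big_seq1.
by rewrite -[X in _ * X = _]mulf_div [LHS]mulrA.
Qed.

End BasicFunction.

Theorem theorem19 (R : realType) (q : Cx R) (lg : Cx R -> Cx R)
    (hq0 : 0 < `|q|) (hq1 : `|q| < 1) (hlg : is_qlog q lg)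
    (r s : nat) (hr : (0 < r)%N) (hs : (0 < s)%N)
    (a : r.-tuple (Cx R)) (b : s.-tuple (Cx R)) (hab : qR_params q a b)
    (alpha beta mu nu z : Cx R) (hmu : 0 < complex.Re mu) (hz : z != 0) :
  let f := fun x : Cx R => qR q lg a b alpha beta (1 / x) in
  let D := [set x : Cx R | x != 0 /\ qR_cvg q lg a b alpha beta (1 / x)] in
  let qnu := cpow lg q nu in
  let qnumu := cpow lg q (nu + mu) in
  let Gnu := qGamma q lg nu in
  let Gnumu := qGamma q lg (nu + mu) in
  (qR_params q (rcons_tuple a qnu) (rcons_tuple b qnumu) ->
   koberK_defined q lg nu mu D f z ->
   let w := 1 / z * cpow lg q mu in
   qR_cvg q lg (rcons_tuple a qnu) (rcons_tuple b qnumu) alpha beta w /\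
   koberK q lg nu mu f z =
     Gnu / Gnumu *
     qR q lg (rcons_tuple a qnu) (rcons_tuple b qnumu) alpha beta w)
  /\
  (qR_params q (rcons_tuple a qnumu) (rcons_tuple b qnu) ->
   koberD_defined q lg nu mu D f z ->
   let w := 1 / z * cpow lg q (- mu) in
   qR_cvg q lg (rcons_tuple a qnumu) (rcons_tuple b qnu) alpha beta w /\
   koberD q lg nu mu f z =
     Gnumu / Gnu *
     qR q lg (rcons_tuple a qnumu) (rcons_tuple b qnu) alpha beta w).
Proof.
move=> f D qnu qnumu Gnu Gnumu.
have q0 : q != 0 by rewrite -normr_gt0.
have q1 : modulus q < 1 by move: hq1; rewrite normE ltcR.
pose c := qR_term q lg a b alpha beta 1.
have cE y : qR_term q lg a b alpha beta (1 / y) = (fun l => c l * (1 / y) ^+ l).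
  by apply/funext => l; rewrite qR_term_powerE.
have hf y : f y = limn (series (fun l => c l * (1 / y) ^+ l)).
  by rewrite /f /qR cE.
have DE : D = [set y | y != 0 /\ cvgn (series (fun l => c l * (1 / y) ^+ l))].
  by apply/seteqP; split=> y; rewrite /D /= /qR_cvg cE.
have params x y : qR_params q (rcons_tuple a x) (rcons_tuple b y) ->
    (forall l, x * q ^+ l != 1) /\ (forall l, y * q ^+ l != 1).
  by case=> ha hb; split=> l; [have := ha ord_max l|have := hb ord_max l];
    rewrite (tnth_nth 0) /= nth_rcons size_tuple ltnn eqxx.
have conclude (x y w K G : Cx R) :
    G != 0 ->
    series (fun l => c l * (qpoch q x l / qpoch q y l) * w ^+ l) @ \oo -->
      K / G ->
    qR_cvg q lg (rcons_tuple a x) (rcons_tuple b y) alpha beta w /\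
    K = G * qR q lg (rcons_tuple a x) (rcons_tuple b y) alpha beta w.
  move=> G0 h.
  have {}h : series (qR_term q lg (rcons_tuple a x) (rcons_tuple b y)
      alpha beta w) @ \oo --> K / G.
    by apply: (cvg_series_eq _ h) => l; rewrite qR_term_rcons.
  have hc : qR_cvg q lg (rcons_tuple a x) (rcons_tuple b y) alpha beta w.
    by apply/cvg_ex; exists (K / G).
  split; first exact: hc.
  have -> : qR q lg (rcons_tuple a x) (rcons_tuple b y) alpha beta w = K / G.
    exact: (cvg_Cx_unique hc h).
  by rewrite mulrC divfK.
split=> /params[h1 h2]; rewrite DE => hdef w.
  apply: conclude; first exact: qGamma_ratio_neq0.
  exact: koberK_series.
apply: conclude; last exact: koberD_series.
by rewrite -invf_div invr_eq0; exact: qGamma_ratio_neq0.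
Qed.
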